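(* Let $\mathcal{F}=\{f_k\}_{k=1}^m$ be a CPLIFS whose generated self-similar IFS $\mathcal{S}_{\mathcal{F}}$ has no exact overlapping. Then for every $\varepsilon>0$ there exists $\delta>0$ such that for every CPLIFS $\widehat{\mathcal{F}}=\{\widehat f_k\}_{k=1}^m$ which is $\delta$-close to $\mathcal{F}$, \[ |s_{\mathcal{F}}-s_{\widehat{\mathcal{F}}}|<\varepsilon, \] where $s_{\mathcal{F}}$ and $s_{\widehat{\mathcal{F}}}$ are the natural dimensions of $\mathcal{F}$ and $\widehat{\mathcal{F}}$.
   Context: A CPLIFS (continuous piecewise linear iterated function system) is a family $\mathcal{F}=\{f_k\}_{k=1}^m$, $m\ge 2$, of continuous piecewise linear maps $f_k:\mathbb{R}\to\mathbb{R}$, where $f_k$ has finitely many breaking points $b_{k,1}<\dots<b_{k,l(k)}$ ($l(k)\ge 0$), which determine the open intervals of linearity $J_{k,1}=(-\infty,b_{k,1})$, $J_{k,i}=(b_{k,i-1},b_{k,i})$ for $2\le i\le l(k)$, $J_{k,l(k)+1}=(b_{k,l(k)},\infty)$; on $J_{k,i}$ the map $f_k$ has constant slope $\rho_{k,i}\in(-1,1)\setminus\{0\}$, with $\rho_{k,i}\neq\rho_{k,i+1}$. Let $I=[u,v]$ be the smallest nonempty compact interval with $f_k(I)\subset I$ for all $k$ (if all $f_k$ share a common fixed point $\phi$ so that the attractor is a point, set $I=[\phi-\tfrac12,\phi+\tfrac12]$). The attractor $\Lambda$ is the unique nonempty compact set with $\Lambda=\bigcup_k f_k(\Lambda)$.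 Cylinder intervals: $I_{i_1\dots i_n}=f_{i_1}\circ\dots\circ f_{i_n}(I)$. Natural pressure: $\Phi(s)=\limsup_{n\to\infty}\frac1n\log\sum_{(i_1,\dots,i_n)\in[m]^n}|I_{i_1\dots i_n}|^s$; it is strictly decreasing on $[0,\infty)$ with $\Phi(0)>0$ and $\Phi(s)\to-\infty$, and the natural dimension $s_{\mathcal{F}}$ is its unique zero. Generated self-similar IFS: $\mathcal{S}_{\mathcal{F}}=\{S_{k,i}\}_{k\in[m],i\in[l(k)+1]}$, where $S_{k,i}(x)=\rho_{k,i}x+t_{k,i}$ is the similarity agreeing with $f_k$ on $J_{k,i}$. A self-similar IFS $\{S_a\}_{a\in\mathcal{A}}$ has no exact overlapping if for every $n\ge1$ and words $\mathbf{i},\mathbf{j}\in\mathcal{A}^n$, $S_{\mathbf{i}}\equiv S_{\mathbf{j}}$ implies $\mathbf{i}=\mathbf{j}$ (where $S_{a_1\dots a_n}=S_{a_1}\circ\dots\circ S_{a_n}$). Monotonicity partition: let $\mathcal{I}=\bigcup_k f_k(I)$ and, for each $k,j$, let the branch $f_{k,j}^{-1}:f_k(J_{k,j})\to J_{k,j}$ be the inverse of $f_k|_{J_{k,j}}$. The set of critical points is $\mathcal{K}=\{f_k(u),f_k(v):k\in[m]\}\cup\{f_k(b_{k,j}):k\in[m],j\in[l(k)]\}\cup\{x\in\mathcal{I}:\exists\,(k_1,j_1)\neq(k_2,j_2)\text{ with }f^{-1}_{k_1,j_1}(x)=f^{-1}_{k_2,j_2}(x)\}$. The monotonicity partition $\mathcal{Z}_0$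 is the partition of $\mathcal{I}$ into closed intervals determined by $\mathcal{K}$. Closeness: two closed intervals $[c,d],[\hat c,\hat d]$ are $\varepsilon$-close if $|c-\hat c|<\varepsilon$ and $|d-\hat d|<\varepsilon$; two finite partitions $\{Y_1,\dots,Y_N\}$, $\{\widehat Y_1,\dots,\widehat Y_N\}$ (same cardinality, ordered left to right) are $\varepsilon$-close if $Y_j,\widehat Y_j$ are $\varepsilon$-close for all $j$. Two CPLIFSs $\mathcal{F}=\{f_k\}$, $\widehat{\mathcal{F}}=\{\widehat f_k\}$ are $\varepsilon$-close if (a) their monotonicity partitions are $\varepsilon$-close, (b) $f_k$ and $\widehat f_k$ have the same number of breaking points for all $k$, (c) $|\log|\rho_{k,j}|-\log|\widehat\rho_{k,j}||<\varepsilon$ for all $k,j$ (slopes of $f_k$ and $\widehat f_k$ on corresponding intervals of linearity), (d) $\|f_k-\widehat f_k\|_\infty<\varepsilon$ for all $k$. *)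

(* Defs.v *)
From HB Require Import structures.
From mathcomp Require Import all_boot all_order all_algebra.
From mathcomp Require Import all_classical all_reals all_analysis.
Set Implicit Arguments. Unset Strict Implicit. Unset Printing Implicit Defensive.
Import Order.TTheory GRing.Theory Num.Theory.
Import numFieldNormedType.Exports.
Local Open Scope ring_scope.
Local Open Scope classical_set_scope.

Section CPLIFS.
Variable R : realType.

(* Breakpoints b = [:: b_1; ...; b_l] (indexed 0..l-1), slopes
   rho = [:: rho_1; ...; rho_(l+1)] (indexed 0..l).  Interval of linearity
   number i (0-based) is J_i = (b_(i-1), b_i) with the conventions
   b_(-1) = -oo, b_l = +oo. *)
Definition inJ (b : seq R) (i : nat) (x : R) : bool :=
  ((i == 0%N) || (b`_(i.-1) < x)) && ((i == size b) || (x < b`_i)).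

Definition is_PL (f : R -> R) (b rho : seq R) : Prop :=
  [/\ sorted <%R b,
      size rho = (size b).+1,
      (forall i, (i < size rho)%N -> -1 < rho`_i < 1 /\ rho`_i != 0),
      (forall i, (i.+1 < size rho)%N -> rho`_i != rho`_i.+1) &
      continuous f /\
      (forall i x y, (i < size rho)%N -> inJ b i x -> inJ b i y ->
         f y - f x = rho`_i * (y - x))].

Definition is_CPLIFS (m : nat) (F : 'I_m -> R -> R) (bp sl : 'I_m -> seq R)
  : Prop := (2 <= m)%N /\ forall k, is_PL (F k) (bp k) (sl k).

Definition comp (m : nat) (F : 'I_m -> R -> R) (w : seq 'I_m) : R -> R :=
  foldr (fun k g => F k \o g) id w.

Definition invariant (m : nat) (F : 'I_m -> R -> R) (u v : R) : Prop :=
  u <= v /\ forall k x, u <= x <= v -> u <= F k x <= v.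

Definition is_I (m : nat) (F : 'I_m -> R -> R) (u v : R) : Prop :=
  (forall phi, (forall k, F k phi = phi) -> u = phi - 2^-1 /\ v = phi + 2^-1) /\
  ((~ exists phi, forall k, F k phi = phi) ->
     invariant F u v /\ forall u' v', invariant F u' v' -> u' <= u /\ v <= v').

Definition img_len (g : R -> R) (u v : R) : R :=
  sup [set y | exists2 x, u <= x <= v & g x = y] -
  inf [set y | exists2 x, u <= x <= v & g x = y].

Definition pressure (m : nat) (F : 'I_m -> R -> R) (u v s : R) : \bar R :=
  limn_esup (fun n : nat =>
    ((n%:R)^-1 * ln (\sum_(w : n.-tuple 'I_m) powR (img_len (comp F w) u v) s))%:E).

Definition natural_dim (m : nat) (F : 'I_m -> R -> R) (s : R) : Prop :=
  0 <= s /\ exists u v, is_I F u v /\ pressure F u v s = 0%E.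

(* a point of J_i, used to compute the translation of S_{k,i} *)
Definition ptJ (b : seq R) (i : nat) : R :=
  if size b == 0%N then 0
  else if i == 0%N then b`_0 - 1
  else if i == size b then b`_(size b).-1 + 1
  else (b`_(i.-1) + b`_i) / 2.

(* the similarity S_{k,i} agreeing with f_k on J_{k,i} *)
Definition sim (m : nat) (F : 'I_m -> R -> R) (bp sl : 'I_m -> seq R)
    (a : 'I_m * nat) : R -> R :=
  let rho := (sl a.1)`_(a.2) in
  let p := ptJ (bp a.1) a.2 in
  fun x => rho * x + (F a.1 p - rho * p).

Definition sim_comp (m : nat) (F : 'I_m -> R -> R) (bp sl : 'I_m -> seq R)
    (w : seq ('I_m * nat)) : R -> R :=
  foldr (fun a g => sim F bp sl a \o g) id w.

Definition valid_letter (m : nat) (sl : 'I_m -> seq R) (a : 'I_m * nat) : bool :=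
  (a.2 < size (sl a.1))%N.

Definition no_exact_overlap (m : nat) (F : 'I_m -> R -> R) (bp sl : 'I_m -> seq R)
  : Prop :=
  forall w w' : seq ('I_m * nat), (1 <= size w)%N -> size w = size w' ->
    all (valid_letter sl) w -> all (valid_letter sl) w' ->
    (forall x, sim_comp F bp sl w x = sim_comp F bp sl w' x) -> w = w'.

Definition in_calI (m : nat) (F : 'I_m -> R -> R) (u v x : R) : Prop :=
  exists k y, u <= y <= v /\ F k y = x.

Definition crit (m : nat) (F : 'I_m -> R -> R) (bp sl : 'I_m -> seq R)
    (u v x : R) : Prop :=
  (exists k, x = F k u \/ x = F k v) \/
  (exists k j, (j < size (bp k))%N /\ x = F k (bp k)`_j) \/
  (in_calI F u v x /\
   exists k1 j1 k2 j2 y, (k1, j1) <> (k2, j2) /\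
     (j1 < size (sl k1))%N /\ (j2 < size (sl k2))%N /\
     inJ (bp k1) j1 y /\ inJ (bp k2) j2 y /\ F k1 y = x /\ F k2 y = x).

(* Z (list of closed intervals [c,d] as pairs, ordered left to right) is the
   monotonicity partition of calI determined by the critical points *)
Definition mono_partition (m : nat) (F : 'I_m -> R -> R) (bp sl : 'I_m -> seq R)
    (u v : R) (Z : seq (R * R)) : Prop :=
  [/\ sorted (fun p q : R * R => p.1 < q.1) Z,
      (forall c d, (c, d) \in Z <->
         [/\ c < d, crit F bp sl u v c, crit F bp sl u v d,
             (forall x, c < x < d -> ~ crit F bp sl u v x) &
             (forall x, c <= x <= d -> in_calI F u v x)]) &
      (forall x, in_calI F u v x <-> exists2 p, p \in Z & p.1 <= x <= p.2)].

Definition eps_close (eps : R) (m : nat)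
    (F : 'I_m -> R -> R) (bp sl : 'I_m -> seq R)
    (Fh : 'I_m -> R -> R) (bph slh : 'I_m -> seq R) : Prop :=
  [/\ (exists u v uh vh Z Zh,
        [/\ is_I F u v /\ is_I Fh uh vh, mono_partition F bp sl u v Z,
            mono_partition Fh bph slh uh vh Zh, size Z = size Zh &
            forall j, (j < size Z)%N ->
              `|(nth (0,0) Z j).1 - (nth (0,0) Zh j).1| < eps /\
              `|(nth (0,0) Z j).2 - (nth (0,0) Zh j).2| < eps]),
      (forall k, size (bp k) = size (bph k)),
      (forall k j, (j < size (sl k))%N ->
         `|ln `|(sl k)`_j| - ln `|(slh k)`_j| | < eps) &
      (forall k, exists2 e, e < eps & forall x, `|F k x - Fh k x| <= e)].

End CPLIFS.

(* Main.v *)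
Require Import Defs.
From HB Require Import structures.
From mathcomp Require Import all_boot all_order all_algebra.
From mathcomp Require Import all_classical all_reals all_analysis.
From mathcomp Require Import ring lra zify.
Import Order.TTheory GRing.Theory Num.Theory.
Import numFieldNormedType.Exports.
Set Implicit Arguments. Unset Strict Implicit.
Local Open Scope ring_scope.

(* The cylinder lengths of the two systems are compared word by word. Since all maps
   contract, the cylinders I_w and Ih_w stay at distance O(delta) of each other. Adding an
   outer letter k to w multiplies both lengths by almost the same slope as soon as I_w is
   small and far from the breakpoints of f_k; otherwise it changes them by a bounded factor.
   Without exact overlaps no breakpoint b of f_k satisfies f_w(f_k(b)) = b: the left and
   right germs there would be distinct words of similarities with the common fixed point b,
   so that their two concatenations would coincide. By finiteness and continuity, returns to
   a small neighbourhood of b then take more than N steps, so the bad steps have frequency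
   O(1/N), and |log|I_w| - log|Ih_w|| <= C + n e for all words of length n, with e small.
   This moves the pressure at s by at most s e, while the pressure decreases in s with slope
   at most log r, where r < 1 is a common contraction ratio. *)

(** * Affine pieces of a piecewise linear map, and lengths of images of intervals *)

Section PiecewiseLinear.
Variable R : realType.
Implicit Types (f g : R -> R) (b rho : seq R) (x y z t u v : R).

Lemma continuous_dist f x (e : R) : continuous f -> 0 < e ->
  exists2 d, 0 < d & forall y, `|y - x| < d -> `|f y - f x| < e.
Proof.
move=> cf e0; have /cvgrPdist_lt/(_ e e0) := cf x.
case/nbhs_ballP => d /= d0 H; exists d => // y yx.
rewrite distrC; apply: H; by rewrite /ball /= distrC.
Qed.

(** Linearity is given on open intervals only; continuity carries an affine formula to an endpoint,
    approached along a ray in either direction. *)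
Lemma continuous_ray f x t (A B r : R) : continuous f -> 0 < r ->
  (forall s, 0 < s <= r -> f (x + s * t) = A + s * B) -> f x = A.
Proof.
move=> cf r0 H; apply/eqP/negPn/negP => /negP neq.
have e0 : 0 < `|f x - A| / 2 by rewrite divr_gt0// normr_gt0 subr_eq0; apply/negP.
set e := `|f x - A| / 2 in e0.
have [d d0 Hd] := continuous_dist x cf e0.
have t0 : 0 < `|t| + 1 by have := normr_ge0 t; lra.
have B0 : 0 < `|B| + 1 by have := normr_ge0 B; lra.
(* Such a step moves [f] by less than [e] and keeps [|s * B|] at most [e], whence
   [|f x - A| < 2 * e], contrary to the choice of [e]. *)
pose s := Num.min r (Num.min (d / 2 / (`|t| + 1)) (e / (`|B| + 1))).
have s0 : 0 < s.
  by rewrite !lt_min r0 /=; apply/andP; split; rewrite divr_gt0// divr_gt0.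
have sr : s <= r by rewrite ge_min lexx.
have sd : s * (`|t| + 1) <= d / 2.
  by rewrite -ler_pdivlMr// !ge_min lexx orbT.
have se : s * (`|B| + 1) <= e.
  by rewrite -ler_pdivlMr// !ge_min lexx !orbT.
have H1 : `|f (x + s * t) - f x| < e.
  apply: Hd; rewrite addrAC subrr add0r normrM gtr0_norm//; nra.
rewrite H ?s0// in H1.
have : `|f x - A| <= `|A + s * B - f x| + `|s * B|.
  rewrite -[X in X <= _]normrN (_ : - (f x - A) = (A + s * B - f x) - s * B); last by ring.
  exact: ler_normB.
rewrite [`|s * B|]normrM (gtr0_norm s0).
have -> : `|f x - A| = 2 * e by rewrite /e mulrC divfK.
nra.
Qed.

Lemma gap_in_inJ b x y : x < y -> (forall c, c \in b -> ~~ (x < c < y)) ->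
  exists2 i, (i <= size b)%N & forall z, x < z < y -> inJ b i z.
Proof.
move=> xy nob; pose z0 := (x + y) / 2.
have z0xy : x < z0 < y by rewrite /z0; lra.
(* The first breakpoint at or beyond the midpoint bounds the gap on the right; [find] returns
   [size b] when there is none, the index of the unbounded last interval. *)
pose i := find (fun c : R => z0 <= c) b.
exists i; first exact: find_size.
move=> z zxy; apply/andP; split.
  case: eqP => //= /eqP; rewrite -lt0n => i0.
  have Hi : (i.-1 < i)%N by rewrite prednK.
  have /= /negbT := before_find 0 Hi; rewrite -ltNge => bz0.
  have := nob b`_i.-1; rewrite mem_nth; last by rewrite (leq_trans Hi)// find_size.
  by move=> /(_ isT); rewrite negb_and -!leNgt => /orP[]; lra.
case: eqP => //= /eqP ne.
have ib : (i < size b)%N by rewrite ltn_neqAle ne find_size.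
have := nob b`_i; rewrite mem_nth// => /(_ isT).
have /= bz0 : z0 <= b`_i.
  by apply: (nth_find 0 (a := fun c : R => z0 <= c)); rewrite has_find.
by rewrite negb_and -!leNgt => /orP[]; lra.
Qed.

Lemma is_PL_continuous f b rho : is_PL f b rho -> continuous f.
Proof. by case=> _ _ _ _ []. Qed.

Lemma is_PL_size f b rho : is_PL f b rho -> size rho = (size b).+1.
Proof. by case. Qed.

Lemma is_PL_affine f b rho i x y : is_PL f b rho -> (i <= size b)%N -> x <= y ->
  (forall z, x < z < y -> inJ b i z) -> f y - f x = rho`_i * (y - x).
Proof.
move=> [_ szr _ _ [cf H]] ib; rewrite le_eqVlt => /orP[/eqP->|xy] J.
  by rewrite !subrr mulr0.
have ir : (i < size rho)%N by rewrite szr ltnS.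
pose m := (x + y) / 2.
have xm : 0 < m - x by rewrite /m; lra.
have ym : 0 < y - m by rewrite /m; lra.
have mJ : inJ b i m by apply: J; lra.
have -> : f x = f m - rho`_i * (m - x).
  apply: (@continuous_ray f x 1 _ (rho`_i) (m - x)) => // s s01.
  have sJ : inJ b i (x + s * 1) by apply: J; rewrite /m in s01; lra.
  have := H _ _ _ ir mJ sJ; lra.
have -> : f y = f m + rho`_i * (y - m).
  apply: (@continuous_ray f y (-1) _ (- rho`_i) (y - m)) => // s s01.
  have sJ : inJ b i (y + s * -1) by apply: J; rewrite /m in s01; lra.
  have := H _ _ _ ir mJ sJ; lra.
lra.
Qed.

Lemma is_PL_gap f b rho x y : is_PL f b rho -> x < y ->
  (forall c, c \in b -> ~~ (x < c < y)) ->
  exists2 i, (i < size rho)%N & forall z1 z2, x <= z1 <= y -> x <= z2 <= y ->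
    f z2 - f z1 = rho`_i * (z2 - z1).
Proof.
move=> fPL xy /(gap_in_inJ xy)[i ib J].
exists i; first by rewrite (is_PL_size fPL) ltnS.
suff H z1 z2 : x <= z1 <= y -> x <= z2 <= y -> z1 <= z2 ->
    f z2 - f z1 = rho`_i * (z2 - z1).
  move=> z1 z2 h1 h2; case: (leP z1 z2) => [|/ltW] z12; first exact: H.
  by have := H z2 z1 h2 h1 z12; lra.
by move=> h1 h2 z12; apply: (is_PL_affine fPL) => // z hz; apply: J; lra.
Qed.

(* Removing the points of [b] one by one: a point inside the interval splits it. *)
Lemma lipschitz_of_gaps f b (r : R) :
  (forall x y, x < y -> (forall c, c \in b -> ~~ (x < c < y)) ->
     `|f y - f x| <= r * (y - x)) ->
  forall x y, x < y -> `|f y - f x| <= r * (y - x).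
Proof.
elim: b => [|p b IH] H; first by move=> x y xy; exact: H.
apply: IH => x y xy nob; case: (boolP (x < p < y)) => [xpy|pn]; last first.
  by apply: H => // c; rewrite inE => /orP[/eqP->//|/nob].
have h1 : `|f p - f x| <= r * (p - x).
  apply: H => [|c]; first lra.
  rewrite inE => /orP[/eqP->|/nob]; [by rewrite !ltxx ?andbF | apply: contra => ?; lra].
have h2 : `|f y - f p| <= r * (y - p).
  apply: H => [|c]; first lra.
  rewrite inE => /orP[/eqP->|/nob]; [by rewrite !ltxx ?andbF | apply: contra => ?; lra].
have := ler_normD (f y - f p) (f p - f x); rewrite addrA subrK; lra.
Qed.

Lemma is_PL_lipschitz f b rho (r : R) : is_PL f b rho ->
  (forall i, (i < size rho)%N -> `|rho`_i| <= r) ->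
  forall x y, `|f y - f x| <= r * `|y - x|.
Proof.
move=> fPL rr.
have H : forall x y, x < y -> `|f y - f x| <= r * (y - x).
  apply: (@lipschitz_of_gaps f b r) => x y xy nob.
  have [i ir ->] := is_PL_gap fPL xy nob; try lra.
  by rewrite normrM [`|y - x|]gtr0_norm ?subr_gt0// ler_wpM2r ?rr//; lra.
move=> x y; case: (ltgtP x y) => xy.
- by rewrite [`|y - x|]gtr0_norm ?subr_gt0// H.
- by rewrite distrC [`|y - x|]distrC [`|x - y|]gtr0_norm ?subr_gt0// H.
- by rewrite xy !subrr normr0 mulr0.
Qed.

(** Bisection: each new point is missed by one open half of the gap found so far, so every point
    costs a factor 2. *)
Lemma large_gap b x y : x < y -> exists x' y', [/\ x <= x', x' < y', y' <= y,
  (y - x) / 2 ^+ size b <= y' - x' & forall c, c \in b -> ~~ (x' < c < y')].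
Proof.
elim: b x y => [|p b IH] x y xy; first by exists x, y; split=> //; rewrite expr0 divr1.
have [x1 [y1 [h1 h2 h3 h4 h5]]] := IH x y xy.
have E : (y - x) / 2 ^+ size (p :: b) = (y - x) / 2 ^+ size b / 2.
  by rewrite /= exprSr invfM mulrA.
rewrite E; set m := (x1 + y1) / 2.
case: (leP p m) => pm.
- exists m, y1; rewrite /m in pm *; split=> //; try lra.
  move=> c; rewrite inE => /orP[/eqP->|/h5]; last by apply: contra => ?; lra.
  by apply/negP => ?; lra.
- exists x1, m; rewrite /m in pm *; split=> //; try lra.
  move=> c; rewrite inE => /orP[/eqP->|/h5]; last by apply: contra => ?; lra.
  by apply/negP => ?; lra.
Qed.

(** The map may fold an interval at its breakpoints, but it is affine on a gap that occupies a fixed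
    share of the interval. *)
Lemma is_PL_expand f b rho (r : R) x y : is_PL f b rho -> 0 <= r ->
  (forall i, (i < size rho)%N -> r <= `|rho`_i|) -> x < y ->
  exists z1 z2, [/\ x <= z1 <= y, x <= z2 <= y &
    r / 2 ^+ size b * (y - x) <= `|f z2 - f z1|].
Proof.
move=> fPL r0 rr xy; have [x1 [y1 [h1 h2 h3 h4 h5]]] := large_gap b xy.
have [i ir H] := is_PL_gap fPL h2 h5.
exists x1, y1; split; try lra.
rewrite H; [|lra..]; rewrite normrM [`|y1 - x1|]gtr0_norm; last lra.
by rewrite mulrAC -mulrA; apply: ler_pM => //; rewrite ?rr// divr_ge0 ?exprn_ge0//; lra.
Qed.

Lemma itvcc_within f u v : continuous f -> {within `[u, v], continuous f}%classic.
Proof. by move=> cf; apply: continuous_subspaceT. Qed.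

(** The extrema are attained, so a length can be handled as a difference of two values. *)
Lemma img_lenP g u v : continuous g -> u <= v -> exists x y,
  [/\ u <= x <= v, u <= y <= v, forall z, u <= z <= v -> g x <= g z <= g y &
      img_len g u v = g y - g x].
Proof.
move=> cg uv; have cg' := itvcc_within (u := u) (v := v) cg.
have [x xI xmin] := EVT_min uv cg'; have [y yI ymax] := EVT_max uv cg'.
exists x, y; rewrite !in_itv/= in xI yI.
have mm z : u <= z <= v -> g x <= g z <= g y.
  by move=> zI; rewrite xmin ?ymax// in_itv.
split=> //; rewrite /img_len.
set S := (X in sup X).
have Sx : S (g x) by exists x. have Sy : S (g y) by exists y.
have ubS : ubound S (g y) by move=> _ [z /mm/andP[_ h] <-].
have lbS : lbound S (g x) by move=> _ [z /mm/andP[h _] <-].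
congr (_ - _); apply/eqP; rewrite eq_le; apply/andP; split.
- by apply: ge_sup => //; exists (g y).
- by apply: ub_le_sup => //; exists (g y).
- by apply: ge_inf => //; exists (g x).
- by apply: lb_le_inf => //; exists (g x).
Qed.

Lemma le_img_len g u v x y : continuous g -> u <= x <= v -> u <= y <= v ->
  `|g y - g x| <= img_len g u v.
Proof.
move=> cg xI yI; have uv : u <= v by lra.
have [x0 [y0 [_ _ mm ->]]] := img_lenP cg uv.
have := mm x xI; have := mm y yI; rewrite ler_norml; lra.
Qed.

Lemma img_len_preimage g u v x y z : continuous g ->
  u <= x <= v -> u <= y <= v -> g x <= z <= g y -> exists2 c, u <= c <= v & g c = z.
Proof.
move=> cg xI yI zI; case: (leP x y) => xy.
- have [|c] := IVT (v := z) xy (itvcc_within (u := x) (v := y) cg).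
    by rewrite ge_min le_max; lra.
  by rewrite in_itv/= => cI <-; exists c => //; lra.
- have [|c] := IVT (v := z) (ltW xy) (itvcc_within (u := y) (v := x) cg).
    by rewrite ge_min le_max; lra.
  by rewrite in_itv/= => cI <-; exists c => //; lra.
Qed.

Lemma img_len_comp_le f g u v (r : R) : continuous f -> continuous g -> u <= v ->
  0 <= r -> (forall x y, `|f y - f x| <= r * `|y - x|) ->
  img_len (f \o g) u v <= r * img_len g u v.
Proof.
move=> cf cg uv r0 H.
have cfg : continuous (f \o g) by move=> x; apply: continuous_comp; [exact: cg|exact: cf].
have [x [y [xI yI _ ->]]] := img_lenP cfg uv.
apply: le_trans (ler_norm _) _; apply: le_trans (H _ _) _.
by rewrite ler_wpM2l// le_img_len.
Qed.

Lemma img_len_comp_ge f b rho g u v (r : R) : is_PL f b rho -> continuous g ->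
  u <= v -> 0 <= r -> (forall i, (i < size rho)%N -> r <= `|rho`_i|) ->
  0 < img_len g u v ->
  r / 2 ^+ size b * img_len g u v <= img_len (f \o g) u v.
Proof.
move=> fPL cg uv r0 rr.
have cfg : continuous (f \o g).
  by move=> x; apply: continuous_comp; [exact: cg|exact: is_PL_continuous fPL _].
have [x [y [xI yI mm ->]]] := img_lenP cg uv; rewrite subr_gt0 => gxy.
have [z1 [z2 [h1 h2 le]]] := is_PL_expand fPL r0 rr gxy.
(* The two points lie between the extrema of [g], so the intermediate value theorem lifts them to
   [[u, v]]. *)
have [c1 c1I E1] := img_len_preimage cg xI yI h1.
have [c2 c2I E2] := img_len_preimage cg xI yI h2.
apply: le_trans le _; rewrite -E1 -E2.
exact: (le_img_len (g := f \o g)).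
Qed.

Lemma img_len_comp_affine f b rho g u v i : is_PL f b rho -> continuous g ->
  u <= v -> (i <= size b)%N -> (forall x, u <= x <= v -> inJ b i (g x)) ->
  img_len (f \o g) u v = `|rho`_i| * img_len g u v.
Proof.
move=> fPL cg uv ib J.
have cfg : continuous (f \o g).
  by move=> x; apply: continuous_comp; [exact: cg|exact: is_PL_continuous fPL _].
have Hf x y : u <= x <= v -> u <= y <= v -> f (g y) - f (g x) = rho`_i * (g y - g x).
  move=> /J Jx /J Jy; case: fPL => _ szr _ _ [_ H]; apply: H => //.
  by rewrite szr ltnS.
apply/eqP; rewrite eq_le; apply/andP; split.
  have [x [y [xI yI _ ->]]] := img_lenP cfg uv.
  apply: le_trans (ler_norm _) _; rewrite /= Hf// normrM.
  by rewrite ler_wpM2l// le_img_len.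
have [x [y [xI yI mm ->]]] := img_lenP cg uv.
have /andP[gxy _] := mm y yI.
rewrite -[X in _ * X <= _]ger0_norm ?subr_ge0// -normrM -Hf//.
exact: (le_img_len (g := f \o g)).
Qed.

End PiecewiseLinear.

(** * Breakpoints and their stability under perturbation *)

Section Breakpoints.
Variable R : realType.
Implicit Types (b : seq R) (x y z t : R).

(** A minimum of finitely many thresholds; the constants uniform over breakpoints, maps and words
    come from it. *)
Lemma uniform_pos (T : eqType) (s : seq T) (P : T -> R -> Prop) :
  (forall a d d', P a d -> 0 < d' <= d -> P a d') ->
  (forall a, a \in s -> exists2 d, 0 < d & P a d) ->
  exists2 d, 0 < d & forall a, a \in s -> P a d.
Proof.
move=> mono; elim: s => [|a s IH] H; first by exists 1.
have [d1 d1_gt0 P1] : exists2 d, 0 < d & P a d by apply: H; rewrite mem_head.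
have [c cs|d2 d2_gt0 P2] := IH; first by apply: H; rewrite inE cs orbT.
exists (Num.min d1 d2); first by rewrite lt_min d1_gt0.
move=> c; rewrite inE => /orP[/eqP->|/P2 Pc].
  by apply: mono P1 _; rewrite lt_min d1_gt0 d2_gt0 ge_min lexx.
by apply: mono Pc _; rewrite lt_min d1_gt0 d2_gt0 ge_min lexx orbT.
Qed.

Lemma sorted_lt_nth b i j : sorted <%R b -> (i < j)%N -> (j < size b)%N -> b`_i < b`_j.
Proof.
move=> sb ij jb; apply: (sorted_ltn_nth lt_trans 0 sb) => //.
by rewrite inE (ltn_trans ij).
Qed.

Lemma sorted_le_nth b i j : sorted <%R b -> (i <= j)%N -> (j < size b)%N -> b`_i <= b`_j.
Proof.
move=> sb; rewrite leq_eqVlt => /orP[/eqP->//|ij jb].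
exact/ltW/sorted_lt_nth.
Qed.

(** Intervals of linearity contain no breakpoint; this separates the two germs at a breakpoint. *)
Lemma inJ_not_across b i c x y : sorted <%R b -> (i <= size b)%N -> c \in b ->
  inJ b i x -> inJ b i y -> ~~ (x < c < y).
Proof.
move=> sb ib /(nthP 0)[j jb <-] /andP[x1 _] /andP[_ y2]; apply/negP => /andP[xc cy].
case: (ltnP j i) => ij.
  case/orP: x1 => [/eqP i0|x1]; first by rewrite i0 in ij.
  have ji : (j <= i.-1)%N by lia.
  have ib' : (i.-1 < size b)%N by lia.
  by have := sorted_le_nth sb ji ib'; lra.
case/orP: y2 => [/eqP E|y2]; first by rewrite E leqNgt jb in ij.
by have := sorted_le_nth sb ij jb; lra.
Qed.

Lemma inJ_ptJ b i : sorted <%R b -> (i <= size b)%N -> inJ b i (ptJ b i).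
Proof.
move=> sb ib; rewrite /inJ /ptJ.
case: (eqVneq (size b) 0%N) => [b0|b0]; first by move: ib; rewrite b0 leqn0 => /eqP->.
case: (eqVneq i 0%N) => [->|i0] /=; first by apply/orP; right; lra.
case: (eqVneq i (size b)) => [->|ib'] /=; first by rewrite andbT; lra.
have ii : (i.-1 < i)%N by rewrite prednK// lt0n.
have := sorted_lt_nth sb ii; rewrite ltn_neqAle ib' ib => /(_ isT) H.
by apply/andP; split; lra.
Qed.

(** The finite set [b] keeps a positive distance from [x], except at [x] itself, which the ray
    leaves at once. Every one-sided germ thus gets its interval of linearity. *)
Lemma inJ_ray b x t : t != 0 -> exists i r, [/\ (i <= size b)%N, 0 < r &
  forall s, 0 < s <= r -> inJ b i (x + s * t)].
Proof.
move=> t0.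
have [a d d' h1 h2|a _|d d0 Hd] :=
    @uniform_pos R b (fun c d => c != x -> d <= `|c - x|).
- by move=> /h1; lra.
- case: (eqVneq a x) => [->|ax]; first by exists 1.
  by exists `|a - x|; rewrite ?normr_gt0 ?subr_eq0.
have t0' : 0 < `|t| by rewrite normr_gt0.
have r0 : 0 < d / 2 / `|t| by rewrite !divr_gt0.
have rt s : 0 < s <= d / 2 / `|t| -> s * `|t| < d.
  by case/andP=> _; rewrite ler_pdivlMr//; lra.
case: (ltrgt0P t) => [tp|tn|/eqP]; last by rewrite (negPf t0).
- have [|c cb|i ib J] := @gap_in_inJ R b x (x + d); first lra.
    apply/negP => xc; have := Hd c cb; rewrite gtr0_norm; last lra.
    by rewrite gt_eqF; [move=> /(_ isT); lra|lra].
  exists i, (d / 2 / `|t|); split=> // s s0; apply: J.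
  have := rt s s0; rewrite gtr0_norm//; nra.
- have [|c cb|i ib J] := @gap_in_inJ R b (x - d) x; first lra.
    apply/negP => xc; have := Hd c cb; rewrite ltr0_norm; last lra.
    by rewrite lt_eqF; [move=> /(_ isT); lra|lra].
  exists i, (d / 2 / `|t|); split=> // s s0; apply: J.
  have := rt s s0; rewrite ltr0_norm//; nra.
Qed.

(** The second difference sees the jump of slope. It vanishes for a map affine around the point and
    moves by at most [4 * d] under a perturbation of size [d], so it detects breakpoints of nearby
    maps. *)
Lemma second_difference (f : R -> R) b rho j (h : R) : is_PL f b rho ->
  (j < size b)%N -> 0 < h ->
  (forall c, c \in b -> c != b`_j -> h <= `|c - b`_j|) ->
  f (b`_j + h) + f (b`_j - h) - 2 * f b`_j = (rho`_j.+1 - rho`_j) * h.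
Proof.
move=> fPL jb h0 gap; have [sb _ _ _ _] := fPL.
have E1 : f (b`_j + h) - f b`_j = rho`_j.+1 * (b`_j + h - b`_j).
  apply: (is_PL_affine fPL) => //; [lra|move=> z zI; apply/andP; split].
    by apply/orP; right; case/andP: zI.
  case: (eqVneq j.+1 (size b)) => //= ne.
  have jb' : (j.+1 < size b)%N by rewrite ltn_neqAle ne.
  have bb := sorted_lt_nth sb (ltnSn j) jb'.
  have := gap b`_j.+1; rewrite mem_nth// gt_eqF// gtr0_norm ?subr_gt0//.
  by move=> /(_ isT isT); lra.
have E2 : f b`_j - f (b`_j - h) = rho`_j * (b`_j - (b`_j - h)).
  apply: (is_PL_affine fPL) => //; [exact: ltnW|lra|move=> z zI; apply/andP; split].
    case: (eqVneq j 0%N) => //= j0.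
    have jj : (j.-1 < j)%N by rewrite prednK// lt0n.
    have bb := sorted_lt_nth sb jj jb.
    have := gap b`_j.-1; rewrite mem_nth ?(ltn_trans jj)// lt_eqF// ltr0_norm ?subr_lt0//.
    by move=> /(_ isT isT); lra.
  by apply/orP; right; case/andP: zI.
lra.
Qed.

(** Between index sets of equal size, this forces a strictly increasing map to be the identity. *)
Lemma strict_mono_gap (l : nat) (sg : nat -> nat) :
  (forall i j, (i < j < l)%N -> (sg i < sg j)%N) ->
  forall i j, (i <= j < l)%N -> (sg i + (j - i) <= sg j)%N.
Proof.
move=> H i; elim=> [|j IH] /andP[ij jl]; first by move: ij; rewrite leqn0 => /eqP->; lia.
move: ij; rewrite leq_eqVlt => /orP[/eqP->|ij]; first by lia.
have := IH; rewrite -ltnS ij (ltn_trans (ltnSn j) jl) => /(_ isT).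
have := H j j.+1; rewrite ltnSn jl => /(_ isT); lia.
Qed.

(* A map close to [f] must bend near each breakpoint of [f], and it has only as many
   breakpoints to do so. *)
Lemma breakpoints_close (f : R -> R) b rho (eta : R) : is_PL f b rho -> 0 < eta ->
  exists2 d, 0 < d & forall (fh : R -> R) bh rhoh, is_PL fh bh rhoh ->
    size b = size bh -> (forall x, `|f x - fh x| <= d) ->
    forall j, (j < size b)%N -> `|b`_j - bh`_j| <= eta.
Proof.
move=> fPL eta0; have [sb szr _ rne _] := fPL.
(* Breakpoints are at least [2 * h0] apart, so the open intervals of radius [h <= h0] around them
   are disjoint. *)
have [a d d' h1 h2|j|h0 h0_gt0 gap] := @uniform_pos _ (iota 0 (size b))
    (fun j d => (j < size b)%N -> forall c, c \in b -> c != b`_j -> d * 2 <= `|c - b`_j|).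
- by move=> /h1 H c /H/[apply]; lra.
- rewrite mem_iota /= add0n => jb.
  have [a d d' h1 h2|a _|d d0 Hd] :=
      @uniform_pos R b (fun c d => c != b`_j -> d * 2 <= `|c - b`_j|).
  + by move=> /h1; lra.
  + case: (eqVneq a b`_j) => [->|ax]; first by exists 1.
    exists (`|a - b`_j| / 2); first by rewrite divr_gt0// normr_gt0 subr_eq0.
    by rewrite divfK.
  by exists d.
pose h := Num.min h0 eta.
have h_gt0 : 0 < h by rewrite lt_min h0_gt0.
have hgap j c : (j < size b)%N -> c \in b -> c != b`_j -> h * 2 <= `|c - b`_j|.
  move=> jb cb cne; have jb' : j \in iota 0 (size b) by rewrite mem_iota.
  by apply: le_trans (gap j jb' jb c cb cne); rewrite ler_pM2r// ge_min lexx.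
(* With this [d] the second difference of [f] at a breakpoint is at least [8 * d], out of reach of
   the error [4 * d] if [fh] were affine nearby. *)
have [a d d' h1 h2|j|d d_gt0 Hd] := @uniform_pos _ (iota 0 (size b))
    (fun j d => (j < size b)%N -> 8 * d <= `|rho`_j.+1 - rho`_j| * h).
- by move=> /h1; lra.
- rewrite mem_iota /= add0n => jb.
  have nz : 0 < `|rho`_j.+1 - rho`_j|.
    by rewrite normr_gt0 subr_eq0 eq_sym; apply: rne; rewrite szr ltnS.
  exists (`|rho`_j.+1 - rho`_j| * h / 8); first by rewrite divr_gt0// mulr_gt0.
  by rewrite mulrC divfK.
exists d => // fh bh rhoh fhPL sbh cl.
have [sbh' _ _ _ _] := fhPL.
have near j : (j < size b)%N -> exists2 i, (i < size bh)%N & `|bh`_i - b`_j| < h.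
  move=> jb; apply: contrapT => nex.
  have xy : b`_j - h < b`_j + h by lra.
  have [c /(nthP 0)[i ib <-]|i ir H] := is_PL_gap fhPL xy.
    apply/negP => bI; apply: nex; exists i => //; rewrite ltr_norml; lra.
  have E1 := H (b`_j - h) b`_j; have E2 := H b`_j (b`_j + h).
  have E : f (b`_j + h) + f (b`_j - h) - 2 * f b`_j = (rho`_j.+1 - rho`_j) * h.
    by apply: (second_difference fPL) => // c cb cne; have := hgap j c jb cb cne; lra.
  have jb' : j \in iota 0 (size b) by rewrite mem_iota.
  have := Hd j jb' jb; rewrite -[X in _ <= _ * X](gtr0_norm h_gt0) -normrM -E => h8.
  have Eh : fh (b`_j + h) + fh (b`_j - h) - 2 * fh b`_j = 0.
    by move: (E1 ltac:(lra) ltac:(lra)) (E2 ltac:(lra) ltac:(lra)); lra.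
  have := cl b`_j; have := cl (b`_j + h); have := cl (b`_j - h).
  rewrite !ler_norml => h1 h2 h3.
  have : `|f (b`_j + h) + f (b`_j - h) - 2 * f b`_j| <= 4 * d by rewrite ler_norml; lra.
  lra.
have /choice[sg sgP] : forall j, exists i, (j < size b)%N ->
    (i < size bh)%N /\ `|bh`_i - b`_j| < h.
  move=> j; case: (ltnP j (size b)) => [/near[i ? ?]|_]; last by exists 0%N.
  by exists i.
have sg_mono i j : (i < j < size b)%N -> (sg i < sg j)%N.
  move=> /andP[ij jb]; have ib := ltn_trans ij jb.
  have [i1 i2] := sgP i ib; have [j1 j2] := sgP j jb.
  rewrite ltnNge; apply/negP => le; have := sorted_le_nth sbh' le i1.
  have bij := sorted_lt_nth sb ij jb.
  have := hgap i b`_j ib (mem_nth _ jb); rewrite gt_eqF// gtr0_norm ?subr_gt0//.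
  move=> /(_ isT); move: i2 j2; rewrite !ltr_norml; lra.
(* Monotonicity gives [j <= sg j] from the left end and [sg j <= j] from the right end, both maps
   having equally many breakpoints. *)
have sg_id j : (j < size b)%N -> sg j = j.
  move=> jb.
  have g1 := @strict_mono_gap _ sg sg_mono 0%N j.
  have g2 := @strict_mono_gap _ sg sg_mono j (size b).-1.
  have [t1 _] := sgP (size b).-1 ltac:(lia).
  have := g1 ltac:(lia); have := g2 ltac:(lia); lia.
move=> j jb; have [_] := sgP j jb; rewrite sg_id// distrC => lt.
by apply: le_trans (ltW lt) _; rewrite ge_min lexx orbT.
Qed.

End Breakpoints.

(** * Compositions along words: contraction and shadowing *)

Section Words.
Variables (R : realType) (m : nat).
Implicit Types (F G : 'I_m -> R -> R) (bp sl : 'I_m -> seq R) (w : seq 'I_m).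

Lemma comp_cat F w1 w2 x : Defs.comp F (w1 ++ w2) x = Defs.comp F w1 (Defs.comp F w2 x).
Proof. by elim: w1 => //= k w1 ->. Qed.

Lemma comp_continuous F w : (forall k, continuous (F k)) -> continuous (Defs.comp F w).
Proof.
move=> cF; elim: w => [|k w IH] /=; first by move=> x; exact: cvg_id.
by move=> x; apply: continuous_comp; [exact: IH|exact: cF].
Qed.

Lemma comp_lipschitz F w (r : R) : 0 <= r ->
  (forall k x y, `|F k y - F k x| <= r * `|y - x|) ->
  forall x y, `|Defs.comp F w y - Defs.comp F w x| <= r ^+ size w * `|y - x|.
Proof.
move=> r0 lipF x y; elim: w => [|k w IH] /=; first by rewrite expr0 mul1r.
by apply: le_trans (lipF _ _ _) _; rewrite exprS -mulrA ler_wpM2l.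
Qed.

(** The error [d] made at a letter is contracted by all outer letters; [d / (1 - r)] sums this
    geometric series and solves [t = d + r * t]. *)
Lemma comp_shadow F G w (r d : R) : 0 <= r < 1 -> 0 <= d ->
  (forall k x y, `|G k y - G k x| <= r * `|y - x|) ->
  (forall k x, `|F k x - G k x| <= d) ->
  forall x y, `|Defs.comp F w x - Defs.comp G w y| <= r ^+ size w * `|x - y| + d / (1 - r).
Proof.
move=> /andP[r0 r1] d0 lipG cl x y.
elim: w => [|k w IH] /=.
  by rewrite expr0 mul1r lerDl divr_ge0// subr_ge0 ltW.
set X := Defs.comp F w x in IH *; set Y := Defs.comp G w y in IH *.
have h1 := cl k X; have h2 := lipG k Y X.
have := ler_normD (F k X - G k X) (G k X - G k Y); rewrite addrA subrK => h3.
have E : d / (1 - r) = d + r * (d / (1 - r)) by field; lra.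
have : r * `|X - Y| <= r * (r ^+ size w * `|x - y| + d / (1 - r)) by rewrite ler_wpM2l.
rewrite exprS [X in _ <= _ + X]E; lra.
Qed.

(** * One-sided germs of compositions as compositions of similarities *)

Section Germs.
Variables (F : 'I_m -> R -> R) (bp sl : 'I_m -> seq R).
Hypothesis FPL : forall k, is_PL (F k) (bp k) (sl k).

Lemma sim_germ k i x t (r : R) : (i <= size (bp k))%N -> 0 < r ->
  (forall s, 0 < s <= r -> inJ (bp k) i (x + s * t)) ->
  forall s, 0 <= s <= r -> F k (x + s * t) = sim F bp sl (k, i) (x + s * t).
Proof.
move=> ib r0 J; have [sb szr _ _ [cF lin]] := FPL k.
have pJ := inJ_ptJ sb ib.
have H s : 0 < s <= r -> F k (x + s * t) = sim F bp sl (k, i) (x + s * t).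
  move=> /J sJ; rewrite /sim /=.
  have := lin i (ptJ (bp k) i) (x + s * t); rewrite szr ltnS => /(_ ib pJ sJ); lra.
move=> s /andP[]; rewrite le_eqVlt => /orP[/eqP<- _|s0 sr]; last by apply: H; rewrite s0.
rewrite mul0r addr0.
apply: (@continuous_ray _ (F k) x t _ ((sl k)`_i * t) r) => // s' /H ->.
by rewrite /sim /=; ring.
Qed.

Lemma sim_comp_affine (a : seq ('I_m * nat)) : exists q : R,
  forall x y, sim_comp F bp sl a y - sim_comp F bp sl a x = q * (y - x).
Proof.
elim: a => [|[k i] a [q Hq]] /=; first by exists 1 => x y; rewrite mul1r.
by exists ((sl k)`_i * q) => x y; rewrite -mulrA -Hq /sim /=; ring.
Qed.

Lemma sim_comp_cat a1 a2 x : sim_comp F bp sl (a1 ++ a2) x =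
  sim_comp F bp sl a1 (sim_comp F bp sl a2 x).
Proof. by elim: a1 => //= a a1 ->. Qed.

(** The direction [t] is any nonzero number rather than a sign, because an inner letter multiplies
    it by its slope and may reverse it. *)
Definition has_germs w := forall x t : R, t != 0 -> exists a r,
  [/\ 0 < r, size a = size w, all (valid_letter sl) a &
      forall s, 0 <= s <= r ->
        Defs.comp F w (x + s * t) = sim_comp F bp sl a (x + s * t)].

Lemma germ_rcons w k i x t (r : R) : has_germs w -> t != 0 ->
  (i <= size (bp k))%N -> 0 < r ->
  (forall s, 0 < s <= r -> inJ (bp k) i (x + s * t)) -> exists a r',
  [/\ 0 < r', size a = size w, all (valid_letter sl) (rcons a (k, i)) &
      forall s, 0 <= s <= r' -> Defs.comp F (rcons w k) (x + s * t) =
        sim_comp F bp sl (rcons a (k, i)) (x + s * t)].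
Proof.
move=> gw t0 ib r0 J; have H := sim_germ ib r0 J.
have [_ szr /(_ i) Hrho _ _] := FPL k.
rewrite szr ltnS in Hrho; have [_ rho0] := Hrho ib.
have [a [r1 [r1_gt0 sza va Ha]]] := gw (F k x) ((sl k)`_i * t) (mulf_neq0 rho0 t0).
exists a, (Num.min r r1); split => //.
- by rewrite lt_min r0.
- by rewrite all_rcons va andbT /valid_letter /= szr ltnS.
move=> s /andP[s0]; rewrite le_min => /andP[sr sr1].
rewrite -!cats1 comp_cat sim_comp_cat /= -H ?s0//.
suff -> : F k (x + s * t) = F k x + s * ((sl k)`_i * t) by apply: Ha; rewrite s0.
have := H 0; rewrite lexx (ltW r0) mul0r addr0 => /(_ isT) ->.
by rewrite H ?s0// /sim /=; ring.
Qed.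

Lemma has_germs_comp w : has_germs w.
Proof.
elim/last_ind: w => [|w k IH] x t t0; first by exists [::], 1.
have [i [r [ib r0 J]]] := inJ_ray (bp k) x t0.
have [a [r' [r'0 sza va Ha]]] := germ_rcons IH t0 ib r0 J.
by exists (rcons a (k, i)), r'; rewrite !size_rcons sza.
Qed.

(* If [comp F (rcons w k)] fixed [b], its left and right germs at [b] would be two
   similarities fixing [b]; these commute, which is an exact overlap of the two
   concatenations, while the innermost letters differ since [b] is a breakpoint of [F k]. *)
Lemma breakpoint_not_periodic w k b : no_exact_overlap F bp sl -> b \in bp k ->
  Defs.comp F (rcons w k) b != b.
Proof.
move=> neo bk; apply/eqP => fixb.
have [sb _ _ _ _] := FPL k.
have [i1 [r1 [ib1 r10 J1]]] := @inJ_ray R (bp k) b 1 (oner_neq0 _).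
have n1 : -1 != 0 :> R by rewrite oppr_eq0 oner_neq0.
have [i2 [r2 [ib2 r20 J2]]] := @inJ_ray R (bp k) b (-1) n1.
have [a1 [s1 [s10 sza1 va1 H1]]] := germ_rcons (has_germs_comp w) (oner_neq0 _) ib1 r10 J1.
have [a2 [s2 [s20 sza2 va2 H2]]] := germ_rcons (has_germs_comp w) n1 ib2 r20 J2.
have ne : i1 != i2.
  apply/eqP => E; rewrite -E in J2.
  have h1 : inJ (bp k) i1 (b + r1 * 1) by apply: J1; rewrite r10 lexx.
  have h2 : inJ (bp k) i1 (b + r2 * -1) by apply: J2; rewrite r20 lexx.
  by have := inJ_not_across sb ib1 bk h2 h1; apply/negP/negPn; lra.
set A1 := rcons a1 _ in va1 H1; set A2 := rcons a2 _ in va2 H2.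
have f1 : sim_comp F bp sl A1 b = b.
  by have := H1 0; rewrite lexx (ltW s10) mul0r addr0 fixb => /(_ isT) <-.
have f2 : sim_comp F bp sl A2 b = b.
  by have := H2 0; rewrite lexx (ltW s20) mul0r addr0 fixb => /(_ isT) <-.
have szA : size A1 = size A2 by rewrite !size_rcons sza1 sza2.
have [q1 Q1] := sim_comp_affine A1; have [q2 Q2] := sim_comp_affine A2.
have S1 y : sim_comp F bp sl A1 y = b + q1 * (y - b).
  by have := Q1 b y; rewrite f1; lra.
have S2 y : sim_comp F bp sl A2 y = b + q2 * (y - b).
  by have := Q2 b y; rewrite f2; lra.
have : A1 ++ A2 = A2 ++ A1.
  apply: neo; rewrite ?all_cat ?va1 ?va2//.
  - by rewrite size_cat size_rcons.
  - by rewrite !size_cat addnC.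
  by move=> x; rewrite !sim_comp_cat !(S1, S2); ring.
move/eqP; rewrite eqseq_cat// => /andP[/eqP E _].
by move: E; rewrite /A1 /A2 => /eqP; rewrite eqseq_rcons xpair_eqE (negPf ne) !andbF.
Qed.

End Germs.

End Words.

(** * Frequency of visits near breakpoints *)

Section Visits.
Variables (R : realType) (m : nat) (F : 'I_m -> R -> R) (bp sl : 'I_m -> seq R).
Implicit Types (w : seq 'I_m) (k : 'I_m).

(** Consecutive marks are at least [N] apart, so all but one of them account for [N] entries
    each. *)
Lemma count_sparse (N : nat) (s : seq bool) :
  (forall i j, (i < j)%N -> nth false s i -> nth false s j -> (N <= j - i)%N) ->
  (N * count id s <= size s + N)%N.
Proof.
move=> sp; case: (boolP (has id s)) => [hs|]; last first.
  by rewrite has_count -eqn0Ngt => /eqP->; rewrite muln0.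
(* Adding the position of the first mark makes the bound inductive. *)
suff : (N * count id s + find id s <= size s + N)%N by lia.
elim: s sp hs => [//|a s IH] sp hs /=.
have sp' i j : (i < j)%N -> nth false s i -> nth false s j -> (N <= j - i)%N.
  by move=> ij si sj; have := sp i.+1 j.+1; rewrite subSS; exact.
case: (boolP (has id s)) => hs'; last first.
  move: hs hs' => /=; rewrite orbC => /orP[->//|->] /=.
  by rewrite has_count -eqn0Ngt => /eqP->; lia.
have := IH sp' hs'; case: a sp {hs} => sp /=; last by lia.
have := sp 0%N (find id s).+1 isT isT; rewrite /= (nth_find false hs') => /(_ isT); lia.
Qed.

(** Arithmetic of a budget, the visit count plus the length truncated at [t]: it grows at every bad
    letter, where the inner word is short or leads near a breakpoint. *)
Lemma minn_step_bad (a b s t : nat) (q : bool) : (a + q <= b)%N -> (s < t)%N || q ->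
  (a + minn s t + 1 <= b + minn s.+1 t)%N.
Proof. by move=> ab /orP[st|Eq]; [|rewrite Eq in ab]; lia. Qed.

Lemma minn_step (a b s t : nat) (q : bool) : (a + q <= b)%N ->
  (a + minn s t <= b + minn s.+1 t)%N.
Proof. lia. Qed.

(** Letters are read from the outermost one, so a smaller index is a later time in the orbit of
    [x0]. *)
Fixpoint visits (x0 eta : R) k (b : R) w : seq bool :=
  if w is k' :: w' then
    ((k' == k) && (`|Defs.comp F w' x0 - b| <= eta)) :: visits x0 eta k b w'
  else [::].

Lemma size_visits x0 eta k b w : size (visits x0 eta k b w) = size w.
Proof. by elim: w => //= k' w ->. Qed.

Lemma nth_visits x0 eta k b w j : nth false (visits x0 eta k b w) j ->
  exists v w', [/\ w = v ++ k :: w', size v = j & `|Defs.comp F w' x0 - b| <= eta].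
Proof.
elim: w j => [|k' w IH] [|j] //=.
  by case/andP => /eqP-> le; exists [::], w.
by move=> /IH[v [w' [-> <- le]]]; exists (k' :: v), w'.
Qed.

Hypothesis lipF : forall k x y, `|F k y - F k x| <= `|y - x|.

(** The letters between two visits, inner letter [k] included, bring a point near [b] back near [b].
    Their composition is nonexpansive, so it would return [b] itself within [2 * eta]. *)
Lemma visits_sparse x0 (eta : R) k b (N : nat) w :
  (forall v, (size v <= N)%N -> 2 * eta < `|Defs.comp F (rcons v k) b - b|) ->
  forall i j, (i < j)%N -> nth false (visits x0 eta k b w) i ->
    nth false (visits x0 eta k b w) j -> (N <= j - i)%N.
Proof.
move=> far; elim: w => [|k' w IH] [|i] [|j] //=; last by rewrite ltnS subSS; exact: IH.
move=> _ /andP[_ le1] /nth_visits[v [w' [Ew <- le2]]]; rewrite subn0.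
case: (leqP (size v) N) => [svN|]; last by lia.
have := far v svN; rewrite Ew -cat_rcons comp_cat in le1.
have lip1 k0 x y : `|F k0 y - F k0 x| <= 1 * `|y - x| by rewrite mul1r.
have := comp_lipschitz (rcons v k) ler01 lip1 b (Defs.comp F w' x0).
set X := Defs.comp F (rcons v k) (Defs.comp F w' x0) in le1 *.
rewrite expr1n mul1r => H.
have := ler_distD X (Defs.comp F (rcons v k) b) b.
rewrite [`|_ - X|]distrC; lra.
Qed.

Definition visit_cost (x0 eta : R) w : nat :=
  \sum_k \sum_(b <- bp k) count id (visits x0 eta k b w).

(** Visits to each single breakpoint are sparse, so altogether they have frequency about [1 / N] per
    breakpoint. *)
Lemma visit_cost_bound x0 (eta : R) (N : nat) w :
  (forall v k b, (size v <= N)%N -> b \in bp k ->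
     2 * eta < `|Defs.comp F (rcons v k) b - b|) ->
  (N * visit_cost x0 eta w <= (\sum_k size (bp k)) * (size w + N))%N.
Proof.
move=> far; rewrite /visit_cost big_distrr big_distrl /=; apply: leq_sum => k _.
rewrite big_distrr /= -sum1_size big_distrl /= big_seq [X in (_ <= X)%N]big_seq.
apply: leq_sum => b bk; rewrite mul1n -(size_visits x0 eta k b w).
apply: count_sparse; apply: visits_sparse => v sv; exact: far.
Qed.

Definition near_breakpoint (x0 eta : R) k w :=
  has (fun b => `|Defs.comp F w x0 - b| <= eta) (bp k).

Lemma visit_cost_cons x0 eta k w :
  (visit_cost x0 eta w + near_breakpoint x0 eta k w <= visit_cost x0 eta (k :: w))%N.
Proof.
rewrite /visit_cost /=; under [X in (_ <= X)%N]eq_bigr do rewrite big_split.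
rewrite big_split /= addnC leq_add2r (bigD1 k)//=.
apply: leq_trans (leq_addr _ _).
rewrite /near_breakpoint; case: hasP => // -[b bk le].
by rewrite (big_rem b)//= eqxx le.
Qed.

Lemma uniform_pos_words (P : seq 'I_m -> R -> Prop) (N : nat) :
  (forall w d d', P w d -> 0 < d' <= d -> P w d') ->
  (forall w, exists2 d, 0 < d & P w d) ->
  exists2 d, 0 < d & forall w, (size w <= N)%N -> P w d.
Proof.
move=> mono ex.
have [n d d' H dd w /H/mono|n _|d d0 Hd] := @uniform_pos R _ (iota 0 N.+1)
    (fun n d => forall w, size w = n -> P w d).
- exact.
- have [t d d' H dd|t _|d d0 Hd] := @uniform_pos R _ (enum {: n.-tuple 'I_m})
      (fun t d => P t d); [exact: mono H dd|exact: ex|].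
  by exists d => // w /eqP sw; apply: (Hd (Tuple sw)); rewrite mem_enum.
exists d => // w sw; apply: (Hd (size w)) => //.
by rewrite mem_iota add0n ltnS.
Qed.

Hypothesis FPL : forall k, is_PL (F k) (bp k) (sl k).
Hypothesis neo : no_exact_overlap F bp sl.

(** The absence of exact overlaps enters the estimates here: finitely many breakpoints, none fixed
    by finitely many words, leave a positive gap. *)
Lemma breakpoint_far_return (N : nat) : exists2 eta : R, 0 < eta &
  forall v k b, (size v <= N)%N -> b \in bp k ->
    2 * eta < `|Defs.comp F (rcons v k) b - b|.
Proof.
have [w d d' H dd k b /H|w|eta eta0 H] := @uniform_pos_words
  (fun v d => forall k b, b \in bp k -> 2 * d < `|Defs.comp F (rcons v k) b - b|) N.
- lra.
- have [k d d' H dd b /H|k _|d d0 Hd] := @uniform_pos R _ (enum 'I_m)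
    (fun k d => forall b, b \in bp k -> 2 * d < `|Defs.comp F (rcons w k) b - b|).
  + lra.
  + have [b d d' H dd|b bk|d d0 Hd] := @uniform_pos R _ (bp k)
      (fun b d => 2 * d < `|Defs.comp F (rcons w k) b - b|); [lra| |by exists d].
    have := breakpoint_not_periodic FPL w neo bk; rewrite -subr_eq0 -normr_gt0 => g0.
    by exists (`|Defs.comp F (rcons w k) b - b| / 3); lra.
  by exists d => // k b bk; apply: Hd => //; rewrite mem_enum.
by exists eta => // v k b vN bk; exact: H.
Qed.

End Visits.

(** * Comparison of cylinder lengths *)

Section Compare.
Variables (R : realType) (m : nat).
Implicit Types (w : seq 'I_m) (k : 'I_m).

Definition log_len (F : 'I_m -> R -> R) (u v : R) w : R :=
  ln (img_len (Defs.comp F w) u v).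

Section OneSystem.
Variables (F : 'I_m -> R -> R) (bp sl : 'I_m -> seq R) (u v c r : R).
Hypothesis FPL : forall k, is_PL (F k) (bp k) (sl k).
Hypothesis uv : u < v.
Hypothesis c_gt0 : 0 < c.
Hypothesis slope_ge : forall k i, (i < size (sl k))%N -> c <= `|(sl k)`_i|.
Hypothesis slope_le : forall k i, (i < size (sl k))%N -> `|(sl k)`_i| <= r.

Let comp_cont w : continuous (Defs.comp F w).
Proof. by apply: comp_continuous => k; exact: is_PL_continuous (FPL k). Qed.

Lemma img_len_id : img_len id u v = v - u.
Proof.
have cid' : continuous (@id R) by move=> x; exact: cvg_id.
apply/eqP; rewrite eq_le; apply/andP; split.
  have [x [y [xI yI _ ->]]] := img_lenP cid' (ltW uv); rewrite /=; lra.
have uv' := ltW uv; rewrite -[v - u]ger0_norm ?subr_ge0//.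
by apply: (le_img_len cid'); rewrite lexx uv'.
Qed.

(** No slope vanishes, so no cylinder degenerates and the logarithms never take the default value of
    [ln] at 0. *)
Lemma img_len_gt0 w : 0 < img_len (Defs.comp F w) u v.
Proof.
elim: w => [|k w IH] /=; first by rewrite img_len_id subr_gt0.
have := img_len_comp_ge (FPL k) (comp_cont (w := w)) (ltW uv) (ltW c_gt0) (@slope_ge k) IH.
by apply: lt_le_trans; rewrite mulr_gt0// divr_gt0// exprn_gt0.
Qed.

Lemma log_len_ge (L : nat) k w : (size (bp k) <= L)%N ->
  ln (c / 2 ^+ L) <= log_len F u v (k :: w) - log_len F u v w.
Proof.
move=> kL; have g0 := img_len_gt0 w.
have cL : 0 < c / 2 ^+ L by rewrite divr_gt0// exprn_gt0.
rewrite lerBrDr /log_len -lnM ?posrE//.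
rewrite ler_ln ?posrE ?mulr_gt0//; last exact: img_len_gt0.
have := img_len_comp_ge (FPL k) (comp_cont (w := w)) (ltW uv) (ltW c_gt0) (@slope_ge k) g0.
apply: le_trans; rewrite ler_pM2r// ler_pM2l// lef_pV2 ?posrE ?exprn_gt0//.
by rewrite ler_eXn2l// ltr1n.
Qed.

Hypothesis r_gt0 : 0 < r.

Lemma log_len_le k w : log_len F u v (k :: w) - log_len F u v w <= ln r.
Proof.
have g0 := img_len_gt0 w.
rewrite lerBlDr /log_len -lnM ?posrE//.
rewrite ler_ln ?posrE ?mulr_gt0//; last exact: img_len_gt0.
apply: img_len_comp_le => //; [exact: is_PL_continuous (FPL k)|exact: ltW|exact: ltW|].
exact: is_PL_lipschitz (FPL k) (slope_le (k := k)).
Qed.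

Lemma log_len_size w : log_len F u v w <= ln (v - u) + (size w)%:R * ln r.
Proof.
elim: w => [|k w IH]; first by rewrite /log_len /= img_len_id mul0r addr0.
by have := log_len_le k w; rewrite /= -natr1 mulrDl mul1r; lra.
Qed.

Lemma log_len_affine k w i : (i <= size (bp k))%N ->
  (forall x, u <= x <= v -> inJ (bp k) i (Defs.comp F w x)) ->
  log_len F u v (k :: w) - log_len F u v w = ln `|(sl k)`_i|.
Proof.
move=> ib J; rewrite /log_len /= (img_len_comp_affine (FPL k) _ (ltW uv) ib J)//.
rewrite lnM ?posrE ?img_len_gt0 ?addrK//.
by apply: lt_le_trans c_gt0 (slope_ge _); rewrite (is_PL_size (FPL k)) ltnS.
Qed.

End OneSystem.

(** * Two nearby systems, compared letter by letter *)

Section TwoSystems.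
Variables (F Fh : 'I_m -> R -> R) (bp sl bph slh : 'I_m -> seq R).
Variables (u v uh vh c r d e eta : R).
Hypothesis FPL : forall k, is_PL (F k) (bp k) (sl k).
Hypothesis FhPL : forall k, is_PL (Fh k) (bph k) (slh k).
Hypothesis szb : forall k, size (bp k) = size (bph k).
Hypothesis uv : u < v.
Hypothesis uvh : uh < vh.
Hypothesis c_gt0 : 0 < c.
Hypothesis c_le1 : c <= 1.
Hypothesis e_ge0 : 0 <= e.
Hypothesis r_gt0 : 0 < r.
Hypothesis r_lt1 : r < 1.
Hypothesis slope_ge : forall k i, (i < size (sl k))%N -> c <= `|(sl k)`_i|.
Hypothesis slope_le : forall k i, (i < size (sl k))%N -> `|(sl k)`_i| <= r.
Hypothesis slopeh_ge : forall k i, (i < size (slh k))%N -> c <= `|(slh k)`_i|.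
Hypothesis slopeh_le : forall k i, (i < size (slh k))%N -> `|(slh k)`_i| <= r.
Hypothesis slope_close : forall k i, (i < size (sl k))%N ->
  `|ln `|(sl k)`_i| - ln `|(slh k)`_i| | <= e.
Hypothesis d_ge0 : 0 <= d.
Hypothesis close : forall k x, `|F k x - Fh k x| <= d.
Hypothesis eta_gt0 : 0 < eta.
Hypothesis d_eta : d / (1 - r) <= eta / 4.
Hypothesis bp_close : forall k j, (j < size (bp k))%N -> `|(bp k)`_j - (bph k)`_j| <= eta / 4.

Lemma expr_small (K z : R) : 0 <= K -> 0 < z ->
  exists n0 : nat, forall n, (n0 <= n)%N -> r ^+ n * K <= z.
Proof.
move=> K0 z0.
have H : ((fun n => r ^+ n : R^o) @ \oo --> (0 : R^o))%classic.
  by apply: cvg_expr; rewrite gtr0_norm.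
have zK : 0 < z / (K + 1) by rewrite divr_gt0//; lra.
have /cvgrPdist_lt/(_ _ zK)[n0 _ Hn] := H.
exists n0 => n /Hn /=; rewrite sub0r normrN gtr0_norm ?exprn_gt0//.
rewrite ltr_pdivlMr; last lra.
have : 0 < r ^+ n by rewrite exprn_gt0.
nra.
Qed.

(** Away from breakpoints both cylinders of [w] lie in intervals of linearity of the same index [i],
    so the outer letter multiplies the two lengths by corresponding slopes. *)
Lemma log_len_far_close (t0 : nat) k w :
  (forall n, (t0 <= n)%N -> r ^+ n * (v - u + `|uh - u| + `|vh - u|) <= eta / 4) ->
  (t0 <= size w)%N -> ~~ near_breakpoint F bp u eta k w ->
  `|(log_len F u v (k :: w) - log_len F u v w) -
    (log_len Fh uh vh (k :: w) - log_len Fh uh vh w)| <= e.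
Proof.
move=> small tw /hasPn far; set x := Defs.comp F w u in far.
have {}far b : b \in bp k -> b < x - eta \/ x + eta < b.
  by move=> /far; rewrite -ltNge ltr_normr => /orP[h|h]; [left|right]; lra.
have uv0 := uv; have eta0 := eta_gt0; have d_eta' := d_eta.
have xx : x - eta < x + eta by lra.
have [b /far bx|i ib J] := gap_in_inJ (b := bp k) xx.
  by apply/negP => ?; case: bx; lra.
have {}small := small _ tw.
have ibh : (i <= size (bph k))%N by rewrite -szb.
have lipFh k' y z := is_PL_lipschitz (FhPL k') (slopeh_le (k := k')) y z.
have lipF k' y z := is_PL_lipschitz (FPL k') (slope_le (k := k')) y z.
have rn : 0 < r ^+ size w by rewrite exprn_gt0.
rewrite (log_len_affine FPL uv c_gt0 slope_ge ib); last first.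
  move=> y yI; apply: J; have := comp_lipschitz w (ltW r_gt0) lipF u y.
  rewrite -/x => h.
  have : r ^+ size w * `|y - u| <= eta / 4.
    apply: le_trans small; rewrite ler_pM2l// ger0_norm; last lra.
    have := normr_ge0 (uh - u); have := normr_ge0 (vh - u); lra.
  by move=> /(le_trans h); rewrite ler_norml; lra.
rewrite (log_len_affine FhPL uvh c_gt0 slopeh_ge ibh); last first.
  move=> y yI.
  have r01 : 0 <= r < 1 by rewrite ltW.
  (* One quarter of [eta] pays for the contracted distance of the base points, another for the
     accumulated perturbation. *)
  have h := comp_shadow w r01 d_ge0 lipFh close u y.
  have {}h : `|x - Defs.comp Fh w y| <= eta / 2.
    apply: le_trans h _.
    have : r ^+ size w * `|u - y| <= eta / 4; last by lra.
    apply: le_trans small; rewrite ler_pM2l// distrC.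
    have := ler_norm (vh - u); have := ler_norm (- (uh - u)).
    rewrite normrN ler_norml; have := normr_ge0 (uh - u); have := normr_ge0 (vh - u); lra.
  move: h; rewrite ler_norml => h.
  have /andP[xl xr] : inJ (bp k) i x by apply: J; lra.
  (* Breakpoints of [F k] are more than [eta] away from [x]; shadowing costs [eta / 2] and their
     displacement [eta / 4], so the index [i] persists for [Fh]. *)
  apply/andP; split.
    case: (eqVneq i 0%N) xl => //= i0 xl.
    have ib' : (i.-1 < size (bp k))%N by rewrite prednK ?lt0n// (leq_trans _ ib)// prednK// lt0n.
    have := bp_close ib'; rewrite ler_norml.
    by case: (far _ (mem_nth 0 ib')); lra.
  rewrite -szb; case: (eqVneq i (size (bp k))) xr => //= i0 xr.
  have ib' : (i < size (bp k))%N by rewrite ltn_neqAle i0.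
  have := bp_close ib'; rewrite ler_norml.
  by case: (far _ (mem_nth 0 ib')); lra.
by apply: slope_close; rewrite (is_PL_size (FPL k)) ltnS.
Qed.

Variable N : nat.
Hypothesis N_gt0 : (0 < N)%N.
Hypothesis far_return : forall v k b, (size v <= N)%N -> b \in bp k ->
     2 * eta < `|Defs.comp F (rcons v k) b - b|.

Let L := (\sum_k size (bp k))%N.

(** A good letter costs [e] and a bad one at most [M], while the bad ones number at most a constant
    plus [L / N] times the length. *)
Lemma log_len_close : exists C, forall w,
  `|log_len F u v w - log_len Fh uh vh w| <=
    C + (size w)%:R * (e + - ln (c / 2 ^+ L) * L%:R / N%:R).
Proof.
set M := - ln (c / 2 ^+ L).
have lipF1 k x y : `|F k y - F k x| <= `|y - x|.
  apply: le_trans (is_PL_lipschitz (FPL k) (slope_le (k := k)) x y) _.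
  by rewrite ler_piMl// ltW.
have bL k : (size (bp k) <= L)%N by rewrite /L (bigD1 k)//= leq_addr.
have bhL k : (size (bph k) <= L)%N by rewrite -szb.
have r_le0 : ln r <= 0 by rewrite ln_le0// ltW.
(* This constant bounds the distance from [u] to any point of either base interval. *)
have K0 : 0 <= v - u + `|uh - u| + `|vh - u|.
  by have := uv; have := normr_ge0 (uh - u); have := normr_ge0 (vh - u); lra.
have eta4 : 0 < eta / 4 by rewrite divr_gt0.
have [t0 small] := expr_small K0 eta4.
(* Both increments lie between [- M] and [ln r <= 0]. *)
have step k w : `|(log_len F u v (k :: w) - log_len F u v w) -
    (log_len Fh uh vh (k :: w) - log_len Fh uh vh w)| <= M.
  have := log_len_ge FPL uv c_gt0 slope_ge w (bL k).
  have := log_len_ge FhPL uvh c_gt0 slopeh_ge w (bhL k).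
  have := log_len_le FPL uv c_gt0 slope_ge slope_le r_gt0 k w.
  have := log_len_le FhPL uvh c_gt0 slopeh_ge slopeh_le r_gt0 k w.
  by rewrite ler_norml /M; lra.
have L2 : 0 < (2 : R) ^+ L by rewrite exprn_gt0.
have M0 : 0 <= M.
  rewrite /M oppr_ge0 ln_le0// ler_pdivrMr// mul1r (le_trans c_le1)//.
  by rewrite exprn_ege1// ler1n.
set C0 := `|log_len F u v [::] - log_len Fh uh vh [::]|.
(* The term [minn (size w) t0] pays for the letters added while the cylinders are still long,
   [visit_cost] for those added near a breakpoint. *)
have main w : `|log_len F u v w - log_len Fh uh vh w| <=
    C0 + (size w)%:R * e + M * (visit_cost F bp u eta w + minn (size w) t0)%:R.
  have e0 := e_ge0; elim: w => [|k w IH].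
    by rewrite mul0r addr0 lerDl mulr_ge0.
  have tri := ler_normD (log_len F u v w - log_len Fh uh vh w)
    ((log_len F u v (k :: w) - log_len F u v w) -
      (log_len Fh uh vh (k :: w) - log_len Fh uh vh w)).
  rewrite (_ : _ + (_ - _) = log_len F u v (k :: w) - log_len Fh uh vh (k :: w)) in tri;
    last by ring.
  apply: le_trans tri _; have cons := visit_cost_cons F bp u eta k w.
  rewrite [size (k :: w)]/= -natr1 mulrDl mul1r.
  case: (boolP ((size w < t0)%N || near_breakpoint F bp u eta k w)) => [bad|].
    have le : (visit_cost F bp u eta w + minn (size w) t0 + 1 <=
        visit_cost F bp u eta (k :: w) + minn (size w).+1 t0)%N.
      exact: minn_step_bad cons bad.
    have : M * (visit_cost F bp u eta w + minn (size w) t0 + 1)%:R <=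
        M * (visit_cost F bp u eta (k :: w) + minn (size w).+1 t0)%:R.
      by rewrite ler_wpM2l// ler_nat.
    by rewrite natrD mulrDr mulr1; have := step k w; lra.
  rewrite negb_or -leqNgt => /andP[tw nb].
  have : M * (visit_cost F bp u eta w + minn (size w) t0)%:R <=
      M * (visit_cost F bp u eta (k :: w) + minn (size w).+1 t0)%:R.
    by rewrite ler_wpM2l// ler_nat (minn_step _ _ cons).
  by have := log_len_far_close small tw nb; lra.
exists (C0 + M * (L + t0)%:R) => w; apply: le_trans (main w) _.
have N0 : 0 < N%:R :> R by rewrite ltr0n.
have := visit_cost_bound (bp := bp) lipF1 u w far_return; rewrite -/L => cost.
have {}cost : (visit_cost F bp u eta w)%:R <= L%:R * ((size w)%:R / N%:R + 1) :> R.
  rewrite -(ler_pM2l N0) -natrM (_ : N%:R * _ = (L * (size w + N))%:R) ?ler_nat//.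
  by rewrite natrM natrD; field; rewrite gt_eqF.
have le1 : (visit_cost F bp u eta w + minn (size w) t0)%:R <=
    L%:R * ((size w)%:R / N%:R + 1) + t0%:R :> R.
  by rewrite natrD lerD// ler_nat geq_minr.
have := ler_wpM2l M0 le1; rewrite natrD -/M; lra.
Qed.

End TwoSystems.
End Compare.

(** * From cylinder lengths to zeros of the pressure *)

Section Pressure.
Variable R : realType.

(** As [K / n] vanishes, a negative [kappa] would keep the tail of [a] below a negative number. *)
Lemma limn_esup_eq0_shift (a b : nat -> R) (K kappa : R) :
  limn_esup (fun n => (a n)%:E) = 0%E -> limn_esup (fun n => (b n)%:E) = 0%E ->
  (forall n, (0 < n)%N -> a n <= b n + (n%:R)^-1 * K + kappa) -> 0 <= kappa.
Proof.
move=> ha hb le; rewrite leNgt; apply/negP => k0.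
(* Eventually [b n <= e] and [K / n <= e]; with [kappa = - 3 * e] this gives [a n <= - e]. *)
pose e := - kappa / 3; have e0 : 0 < e by rewrite /e; lra.
have [V VN supV] : exists2 V, \oo%classic V &
    (ereal_sup ((fun n => (b n)%:E) @` V)%classic < e%:E)%E.
  have : (limn_esup (fun n => (b n)%:E) < e%:E)%E by rewrite hb lte_fin.
  by rewrite /limn_esup limf_esupE => /ereal_inf_lt[_ [V VN <-] lt]; exists V.
have [n0 n0K] : exists n0 : nat, `|K| / e < n0%:R.
  by exists (Num.bound (`|K| / e)); rewrite archi_boundP// divr_ge0// ltW.
have n0_gt0 : 0 < n0%:R :> R by apply: le_lt_trans n0K; rewrite divr_ge0// ltW.
pose W := (V `&` [set n | (n0 <= n)%N])%classic.
have WN : \oo%classic W by apply: filterI => //; exact: nbhs_infty_ge.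
have : (limn_esup (fun n => (a n)%:E) <= (- e)%:E)%E.
  rewrite /limn_esup limf_esupE.
  apply: (@le_trans _ _ (ereal_sup ((fun n => (a n)%:E) @` W)%classic)).
    by apply: ereal_inf_lbound; exists W.
  apply: ge_ereal_sup => _ [n [Vn /= nn0] <-]; rewrite lee_fin.
  have bn : b n <= e.
    rewrite -lee_fin; apply: le_trans (ltW supV).
    by apply: ereal_sup_ubound; exists n.
  have n_gt0 : 0 < n%:R :> R by apply: lt_le_trans n0_gt0 _; rewrite ler_nat.
  have : (n%:R)^-1 * K <= e.
    rewrite mulrC ler_pdivrMr// (le_trans (ler_norm K))// mulrC -ler_pdivrMr//.
    by rewrite (le_trans (ltW n0K))// ler_nat.
  have := le n; rewrite -(ltr0n R) n_gt0 => /(_ isT); rewrite /e in bn *; lra.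
by rewrite ha lee_fin; lra.
Qed.

(** The terms compare one by one up to the factor [expR kappa]; [t0] makes the sums positive. *)
Lemma ln_sum_powR_le (T : finType) (A B : T -> R) (s s' kappa : R) (t0 : T) :
  (forall t, 0 < A t) -> (forall t, 0 < B t) ->
  (forall t, s' * ln (A t) <= s * ln (B t) + kappa) ->
  ln (\sum_t powR (A t) s') <= ln (\sum_t powR (B t) s) + kappa.
Proof.
move=> A0 B0 le.
have sum_gt0 (C : T -> R) x : (forall t, 0 < C t) -> 0 < \sum_t powR (C t) x.
  move=> C0; rewrite (bigD1 t0)//= ltr_wpDr ?powR_gt0// sumr_ge0// => t _; exact: powR_ge0.
have hA := sum_gt0 A s' A0; have hB := sum_gt0 B s B0.
rewrite -[kappa]expRK -lnM ?posrE ?expR_gt0// ler_ln ?posrE ?mulr_gt0 ?expR_gt0//.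
rewrite mulr_suml; apply: ler_sum => t _.
by rewrite /powR !gt_eqF// -expRD ler_expR.
Qed.

Variable m : nat.
Hypothesis m_gt0 : (0 < m)%N.
Let word0 n : n.-tuple 'I_m := nseq_tuple n (Ordinal m_gt0).

Variables (F : 'I_m -> R -> R) (u v : R).
Hypothesis F_gt0 : forall w, 0 < img_len (Defs.comp F w) u v.

(** In [s' * log_len G w], the share [s] is compared with [F] and the share [s' - s] is bounded by
    the decay rate [l]. Since both pressures vanish, the rates linear in [n] cannot sum to a
    negative number. *)
Lemma dim_compare (G : 'I_m -> R -> R) (u' v' s s' C C' e l : R) :
  (forall w, 0 < img_len (Defs.comp G w) u' v') ->
  0 <= s -> s <= s' -> pressure F u v s = 0%E -> pressure G u' v' s' = 0%E ->
  (forall w, log_len G u' v' w <= log_len F u v w + (C + (size w)%:R * e)) ->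
  (forall w, log_len G u' v' w <= C' + (size w)%:R * l) ->
  0 <= s * e + (s' - s) * l.
Proof.
move=> G_gt0 s0 ss' pF pG cl up.
apply: (limn_esup_eq0_shift (K := s * C + (s' - s) * C') pG pF) => n n0.
have n_gt0 : 0 < n%:R :> R by rewrite ltr0n.
rewrite -addrA -[X in _ + (_ + X)](mulKf (x := n%:R)) ?gt_eqF//.
rewrite -mulrDr -mulrDr ler_pM2l ?invr_gt0//.
apply: (ln_sum_powR_le (word0 n)) => // w.
have := cl w; have := up w; rewrite size_tuple -/(log_len F u v w) -/(log_len G u' v' w) => h1 h2.
have h3 := ler_wpM2l s0 h2; have h4 : (s' - s) * log_len G u' v' w <= (s' - s) * (C' + n%:R * l).
  by rewrite ler_wpM2l// subr_ge0.
lra.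
Qed.

(** There are [m ^ n] words, so the pressure at [s] is at most [ln m + s * l]; for negative [l] this
    is an a priori bound on the dimension. *)
Lemma dim_upper_bound (s C l : R) : 0 <= s -> pressure F u v s = 0%E ->
  (forall w, log_len F u v w <= C + (size w)%:R * l) -> 0 <= ln m%:R + s * l.
Proof.
move=> s0 pF up.
have z : limn_esup (fun n : nat => (0 : R)%:E) = 0%E.
  by apply: (cvg_limn_einf_sup _).2; exact: cvg_cst.
apply: (limn_esup_eq0_shift (K := s * C) pF z) => n n0.
have n_gt0 : 0 < n%:R :> R by rewrite ltr0n.
rewrite add0r -[X in _ <= _ + X](mulKf (x := n%:R)) ?gt_eqF//.
rewrite -mulrDr ler_pM2l ?invr_gt0//.
(* The comparison family is constantly 1, so that its sum counts the words. *)
have := @ln_sum_powR_le _ (fun w : n.-tuple 'I_m => img_len (Defs.comp F w) u v)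
  (fun=> 1) 0 s (s * C + n%:R * (s * l)) (word0 n).
move=> /(_ (fun w => F_gt0 w) (fun=> ltr01)) H.
apply: le_trans (H _) _.
  move=> w; have := up w; rewrite size_tuple -/(log_len F u v w) => h.
  by have := ler_wpM2l s0 h; lra.
under eq_bigr do rewrite powR1.
rewrite sumr_const card_tuple card_ord natrX lnXn ?ltr0n// -[_ *+ n]mulr_natl; lra.
Qed.

End Pressure.

(** * Nondegenerate base intervals, slope bounds, and continuity of the dimension *)

Lemma is_I_lt (R : realType) (m : nat) (F : 'I_m -> R -> R) (u v : R) :
  is_I F u v -> u < v.
Proof.
move=> [fixp nofix]; case: (pselect (exists phi, forall k, F k phi = phi)) => [[phi H]|H].
  by have [-> ->] := fixp phi H; lra.
have [[uv inv] _] := nofix H.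
(* A one-point invariant interval would be a common fixed point of all the maps. *)
rewrite lt_neqAle uv andbT; apply/eqP => E; apply: H; exists u => k.
by have := inv k u; rewrite -E lexx => /(_ isT); rewrite -eq_le => /eqP.
Qed.

Lemma slope_bounds (R : realType) (m : nat) (F : 'I_m -> R -> R) (bp sl : 'I_m -> seq R) :
  (forall k, is_PL (F k) (bp k) (sl k)) -> exists c : R, [/\ 0 < c, c <= 2^-1 &
    forall k i, (i < size (sl k))%N -> c <= `|(sl k)`_i| <= 1 - c].
Proof.
move=> FPL.
have [k d d' H dd i /H|k _|d d0 Hd] := @uniform_pos R _ (enum 'I_m)
  (fun k d => forall i, (i < size (sl k))%N -> d <= `|(sl k)`_i| <= 1 - d).
- lra.
- have [i d d' H dd /H|i _|d d0 Hd] := @uniform_pos R _ (iota 0 (size (sl k)))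
    (fun i d => (i < size (sl k))%N -> d <= `|(sl k)`_i| <= 1 - d).
  + lra.
  + case: (ltnP i (size (sl k))) => [ik|]; last by exists 1.
    have [_ _ /(_ i ik)[lt1 n0] _ _] := FPL k.
    have g0 : 0 < `|(sl k)`_i| by rewrite normr_gt0.
    have g1 : `|(sl k)`_i| < 1 by rewrite ltr_norml.
    exists (Num.min `|(sl k)`_i| (1 - `|(sl k)`_i|)); first by rewrite lt_min g0; lra.
    by move=> _; rewrite ge_min lexx /= lerBrDr addrC -lerBrDr ge_min lexx orbT.
  by exists d => // i ik; apply: Hd => //; rewrite mem_iota.
exists (Num.min d 2^-1); split.
- by rewrite lt_min d0; lra.
- by rewrite ge_min lexx orbT.
move=> k i ik; have := Hd k; rewrite mem_enum => /(_ isT i ik).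
have : Num.min d 2^-1 <= d by rewrite ge_min lexx.
lra.
Qed.

Theorem theorem1p3 (R : realType) (m : nat) (F : 'I_m -> R -> R)
    (bp sl : 'I_m -> seq R) :
  is_CPLIFS F bp sl -> no_exact_overlap F bp sl ->
  forall eps : R, 0 < eps -> exists2 delta : R, 0 < delta &
    forall (Fh : 'I_m -> R -> R) (bph slh : 'I_m -> seq R),
      is_CPLIFS Fh bph slh -> eps_close delta F bp sl Fh bph slh ->
      forall s sh : R, natural_dim F s -> natural_dim Fh sh ->
        `|s - sh| < eps.
Proof.
move=> [m2 FPL] neo eps eps0.
have m_gt0 : (0 < m)%N by apply: ltn_trans m2.
have [c0 [c0_gt0 c0_half slF]] := @slope_bounds R m F bp sl FPL.
(* Halving [c0] leaves room for the slopes of [Fh] to stay between [c] and [r] as well. *)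
pose c := c0 / 2; pose r := 1 - c.
have c_gt0 : 0 < c by rewrite /c; lra.
have c_le1 : c <= 1 by rewrite /c; lra.
have r_gt0 : 0 < r by rewrite /r /c; lra.
have r_lt1 : r < 1 by rewrite /r /c; lra.
have slope_ge k i : (i < size (sl k))%N -> c <= `|(sl k)`_i|.
  by move=> /slF; rewrite /c; lra.
have slope_le k i : (i < size (sl k))%N -> `|(sl k)`_i| <= r.
  by move=> /slF; rewrite /r /c; lra.
have lnr : ln r < 0 by rewrite ln_lt0// r_gt0.
pose lam := - ln r; have lam_gt0 : 0 < lam by rewrite /lam; lra.
(* [S] bounds the natural dimensions of both systems. *)
pose S := ln m%:R / lam.
have S_ge0 : 0 <= S by rewrite divr_ge0 ?(ltW lam_gt0)// ln_ge0// ler1n.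
(* The dimensions will differ by at most [S * e1 / lam], which this choice makes smaller than
   [eps]. *)
pose e1 := eps * lam / (S + 1).
have e1_gt0 : 0 < e1 by rewrite divr_gt0 ?mulr_gt0//; lra.
have Se1 : S * e1 < eps * lam.
  have -> : eps * lam = (S + 1) * e1 by rewrite /e1; field; lra.
  by rewrite ltr_pM2r//; lra.
pose L := (\sum_k size (bp k))%N.
pose M := - ln (c / 2 ^+ L).
(* Half of the rate [e1] is reserved for bad letters, half for the slope differences at good
   ones. *)
have [N N_gt0 MLN] : exists2 N, (0 < N)%N & M * L%:R / N%:R <= e1 / 2.
  exists (Num.bound `|M * L%:R / (e1 / 2)|).+1 => //.
  have e2 : 0 < e1 / 2 by rewrite divr_gt0.
  rewrite ler_pdivrMr ?ltr0n// [X in _ <= X]mulrC -ler_pdivrMr//.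
  apply: le_trans (ler_norm _) _; apply: le_trans (ltW (archi_boundP (normr_ge0 _))) _.
  by rewrite ler_nat.
have [eta eta_gt0 far_return] := @breakpoint_far_return R m F bp sl FPL neo N.
have eta4 : 0 < eta / 4 by rewrite divr_gt0.
have [k d d' H dd fh bh rhoh fhPL szb cl|k _|db db_gt0 Hdb] :=
  @uniform_pos R _ (enum 'I_m) (fun k d => forall (fh : R -> R) bh rhoh, is_PL fh bh rhoh ->
    size (bp k) = size bh -> (forall x, `|F k x - fh x| <= d) ->
    forall j, (j < size (bp k))%N -> `|(bp k)`_j - bh`_j| <= eta / 4).
- by apply: (H fh bh rhoh) => // x; apply: le_trans (cl x) _; lra.
- by have [d d0 Hd] := breakpoints_close (FPL k) eta4; exists d.
(* [d1] and [d2] are the logarithmic margins for the slopes of [Fh]; [d3] keeps the shadowing error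
   [delta / (1 - r)] within [eta / 4]. *)
pose d1 := ln r - ln (1 - c0); pose d2 := ln c0 - ln c.
have d1_gt0 : 0 < d1.
  by rewrite subr_gt0 ltr_ln ?posrE// /r /c; lra.
have d2_gt0 : 0 < d2 by rewrite subr_gt0 ltr_ln ?posrE// /c; lra.
pose d3 := eta / 4 * (1 - r).
have d3_gt0 : 0 < d3 by rewrite mulr_gt0// subr_gt0.
pose delta := Num.min (e1 / 2) (Num.min db (Num.min d1 (Num.min d2 d3))).
have delta_gt0 : 0 < delta.
  by rewrite !lt_min db_gt0 d1_gt0 d2_gt0 d3_gt0 !andbT divr_gt0.
have [del_e1 del_db del_d1 del_d2 del_d3] :
    [/\ delta <= e1 / 2, delta <= db, delta <= d1, delta <= d2 & delta <= d3].
  by rewrite !ge_min !lexx ?orbT.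
exists delta => // Fh bph slh [_ FhPL] [_ szb slc clo] s sh
  [s_ge0 [u [v [Iuv pF]]]] [sh_ge0 [uh [vh [Iuvh pFh]]]].
have uv := is_I_lt Iuv; have uvh := is_I_lt Iuvh.
have szs k : size (slh k) = size (sl k).
  by rewrite (is_PL_size (FPL k)) (is_PL_size (FhPL k)) szb.
have close k x : `|F k x - Fh k x| <= delta.
  by have [e' e'd H] := clo k; apply: le_trans (H x) _; exact: ltW.
have slh_gt0 k i : (i < size (slh k))%N -> 0 < `|(slh k)`_i|.
  by move=> ik; have [_ _ /(_ i ik)[_ n0] _ _] := FhPL k; rewrite normr_gt0.
have slopeh_ge k i : (i < size (slh k))%N -> c <= `|(slh k)`_i|.
  move=> ik; have g0 := slh_gt0 k i ik; rewrite szs in ik.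
  rewrite -ler_ln ?posrE//.
  have /andP[h1 _] := slF k i ik.
  have : ln c0 <= ln `|(sl k)`_i| by rewrite ler_ln ?posrE// (lt_le_trans c0_gt0).
  by have := slc k i ik; rewrite ltr_norml; rewrite /d2 in del_d2; lra.
have slopeh_le k i : (i < size (slh k))%N -> `|(slh k)`_i| <= r.
  move=> ik; have g0 := slh_gt0 k i ik; rewrite szs in ik.
  rewrite -ler_ln ?posrE//.
  have /andP[h0 h1] := slF k i ik.
  have : ln `|(sl k)`_i| <= ln (1 - c0).
    by rewrite ler_ln ?posrE//; [exact: lt_le_trans h0|lra].
  by have := slc k i ik; rewrite ltr_norml; rewrite /d1 in del_d1; lra.
have slope_close k i : (i < size (sl k))%N ->
    `|ln `|(sl k)`_i| - ln `|(slh k)`_i| | <= e1 / 2.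
  by move=> ik; apply: le_trans (ltW (slc k i ik)) _.
have d_eta : delta / (1 - r) <= eta / 4 by rewrite ler_pdivrMr ?subr_gt0.
have bp_close k j : (j < size (bp k))%N -> `|(bp k)`_j - (bph k)`_j| <= eta / 4.
  move=> jk; have := Hdb k; rewrite mem_enum => /(_ isT _ _ _ (FhPL k) (szb k)).
  by apply=> // x; apply: le_trans (close k x) _.
have e2_ge0 : 0 <= e1 / 2 by rewrite divr_ge0// ltW.
have [C HC] := log_len_close FPL FhPL szb uv uvh c_gt0 c_le1 e2_ge0 r_gt0 r_lt1
  slope_ge slope_le slopeh_ge slopeh_le slope_close (ltW delta_gt0) close eta_gt0
  d_eta bp_close N_gt0 far_return.
rewrite -/L -/M in HC.
have {}HC w : `|log_len F u v w - log_len Fh uh vh w| <= C + (size w)%:R * e1.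
  apply: le_trans (HC w) _; rewrite lerD2l ler_wpM2l//; lra.
have F0 := img_len_gt0 FPL uv c_gt0 slope_ge.
have Fh0 := img_len_gt0 FhPL uvh c_gt0 slopeh_ge.
have upF := log_len_size FPL uv c_gt0 slope_ge slope_le r_gt0.
have upFh := log_len_size FhPL uvh c_gt0 slopeh_ge slopeh_le r_gt0.
have bound (t : R) : 0 <= ln m%:R + t * ln r -> t * e1 < eps * lam.
  move=> h; apply: le_lt_trans Se1; rewrite ler_pM2r// /S ler_pdivlMr// /lam; lra.
rewrite -(ltr_pM2r lam_gt0).
(* The system of smaller dimension is the reference: its dimension multiplies [e1], and the gap
   multiplies [ln r]. *)
case: (leP s sh) => ssh.
- have := dim_compare m_gt0 F0 (C := C) (e := e1) Fh0 s_ge0 ssh pF pFh _ upFh.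
  have := bound _ (dim_upper_bound m_gt0 F0 s_ge0 pF upF).
  rewrite ler0_norm; last lra.
  move=> h1 h2; have : 0 <= s * e1 + (sh - s) * ln r.
    by apply: h2 => w; have := HC w; rewrite ler_norml; lra.
  rewrite /lam in h1 *; lra.
- have := dim_compare m_gt0 Fh0 (C := C) (e := e1) F0 sh_ge0 (ltW ssh) pFh pF _ upF.
  have := bound _ (dim_upper_bound m_gt0 Fh0 sh_ge0 pFh upFh).
  rewrite gtr0_norm; last lra.
  move=> h1 h2; have : 0 <= sh * e1 + (s - sh) * ln r.
    by apply: h2 => w; have := HC w; rewrite ler_norml; lra.
  rewrite /lam in h1 *; lra.
Qed.
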